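(* Let $T:\mathbb{R}^n\to \mathcal{P}(\mathbb{R}^n)$ be a multivalued map that is $h$-monotone. Then the set $$S=\{(x,\xi)\in\mathbb{R}^n\times\mathbb{R}^n: \xi\in T(x),\ x\in\mathrm{dom}(T)\}$$ is rectifiable, in the following sense. Let $D=\{(x,x):x\in\mathbb{R}^n\}$ be the diagonal, let $D^c$ be its complement in $\mathbb{R}^n\times\mathbb{R}^n$, and write $S=(S\cap D)\cup(S\cap D^c)$. (i) For each $(x_0,y_0)\in S\cap D^c$ there is a neighborhood $N$ of $(x_0,y_0)$ such that $S\cap D^c\cap N$ is the image, under a linear transformation of $\mathbb{R}^n\times\mathbb{R}^n$, of a Lipschitz graph, i.e. of a set $\{(u,F(u)):u\in E\}$ with $E\subset\mathbb{R}^n$ and $F:E\to\mathbb{R}^n$ Lipschitz. (ii) $S\cap D$ is the image of $\Pi_1(S\cap D)$ under the Lipschitz map $x\mapsto(x,x)$ from $\mathbb{R}^n$ to $\mathbb{R}^n\times\mathbb{R}^n$, where $\Pi_1(x,y)=x$; that is, $S\cap D$ is $n$-rectifiable in the sense of Federer (Geometric Measure Theory, 3.2.14, Definition (1)).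
   Context: Standing assumptions on the cost: $h\in C^2(\mathbb{R}^n)$ is real-valued, nonnegative, and positively homogeneous of degree $p$ for some $p\ge 2$ (i.e. $h(tx)=t^p h(x)$ for $t>0$), and its Hessian $D^2h(x)$ is positive definite for each $x$ in the unit sphere $S^{n-1}$, so that there are constants $\lambda,\Lambda>0$ with $\lambda|v|^2\le \langle D^2h(x)v,v\rangle\le \Lambda|v|^2$ for all $x\in S^{n-1}$, $v\in\mathbb{R}^n$. $\mathcal{P}(\mathbb{R}^n)$ is the set of all subsets of $\mathbb{R}^n$ (so $T(x)$ may be empty). The domain of $T$ is $\mathrm{dom}(T)=\{x\in\mathbb{R}^n: T(x)\neq\emptyset\}$. The map $T$ is $h$-monotone if $$h(x-\xi)+h(y-\zeta)\le h(x-\zeta)+h(y-\xi)$$ for all $x,y\in\mathrm{dom}(T)$, all $\xi\in T(x)$ and all $\zeta\in T(y)$. A set is $n$-rectifiable in the sense of Federer 3.2.14, Definition (1), if it is the image of some bounded subset of $\mathbb{R}^n$ under a Lipschitz map.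
   Formalization: Federer's n-rectifiability in (ii) is asserted for the intersection of S∩D with every bounded set, since an unbounded S∩D (e.g. T(x)={x}, where S=D) is never a Lipschitz image of a bounded set; for bounded S∩D it is the literal claim. *)

(* Defs.v *)
From HB Require Import structures.
From mathcomp Require Import all_boot all_order all_algebra.
From mathcomp Require Import all_classical all_reals all_analysis.

Set Implicit Arguments.
Unset Strict Implicit.
Unset Printing Implicit Defensive.

Import Order.TTheory GRing.Theory Num.Theory.
Import numFieldNormedType.Exports.

Local Open Scope classical_set_scope.
Local Open Scope ring_scope.

(* Vectors of R^n are row vectors. The normed structure that the library puts
   on ['rV[R]_n] is the sup norm, and the one on a product is the max norm.
   Topology, boundedness and the existence of a Lipschitz constant do not
   depend on the choice of norm; the unit sphere does, so it is defined below
   from the Euclidean inner product. *)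

Definition dotv (R : realType) (n : nat) (u v : 'rV[R]_n) : R :=
  \sum_(i < n) u 0 i * v 0 i.

Definition sphere (R : realType) (n : nat) : set 'rV[R]_n :=
  [set x | dotv x x = 1].

Definition partial (R : realType) (n : nat) (i : 'I_n) (f : 'rV[R]_n -> R)
  : 'rV[R]_n -> R :=
  fun x => 'D_(delta_mx 0 i) f x.

(* The function ['D_v f] is total, with a junk value where the directional
   derivative does not exist, so existence has to be required separately. *)
Definition C1 (R : realType) (n : nat) (f : 'rV[R]_n -> R) : Prop :=
  continuous f /\
  forall i : 'I_n,
    (forall x : 'rV[R]_n, derivable f x (delta_mx 0 i)) /\
    continuous (partial i f).

Definition C2 (R : realType) (n : nat) (f : 'rV[R]_n -> R) : Prop :=
  C1 f /\ forall i : 'I_n, C1 (partial i f).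

Definition hessian (R : realType) (n : nat) (f : 'rV[R]_n -> R)
    (x : 'rV[R]_n) : 'M[R]_n :=
  \matrix_(i < n, j < n) partial i (partial j f) x.

(* For a [C2] function the Hessian is symmetric, so positivity of the quadratic
   form is all there is to require. *)
Definition posdef (R : realType) (n : nat) (A : 'M[R]_n) : Prop :=
  forall v : 'rV[R]_n, v != 0 -> 0 < dotv (v *m A^T) v.

Definition homogeneous (R : realType) (n : nat) (p : R) (f : 'rV[R]_n -> R)
  : Prop :=
  forall (t : R) (x : 'rV[R]_n), 0 < t -> f (t *: x) = t `^ p * f x.

Definition mdom (R : realType) (n : nat) (T : 'rV[R]_n -> set 'rV[R]_n)
  : set 'rV[R]_n :=
  [set x | T x !=set0].

Definition hmonotone (R : realType) (n : nat) (h : 'rV[R]_n -> R)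
    (T : 'rV[R]_n -> set 'rV[R]_n) : Prop :=
  forall x y xi zeta : 'rV[R]_n,
    mdom T x -> mdom T y -> T x xi -> T y zeta ->
    h (x - xi) + h (y - zeta) <= h (x - zeta) + h (y - xi).

Definition mgraph (R : realType) (n : nat) (T : 'rV[R]_n -> set 'rV[R]_n)
  : set ('rV[R]_n * 'rV[R]_n) :=
  [set z | T z.1 z.2 /\ mdom T z.1].

(* Only the values of [F] on [E] matter, so a map [E -> R^n] is represented by
   a total function. *)
Definition Lipschitz_graph (R : realType) (n : nat)
    (G : set ('rV[R]_n * 'rV[R]_n)) : Prop :=
  exists (E : set 'rV[R]_n) (F : 'rV[R]_n -> 'rV[R]_n),
    [lipschitz F u | u in E] /\ G = [set (u, F u) | u in E].

(* Federer, Geometric Measure Theory, 3.2.14 (1). Such a set is bounded, so an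
   unbounded set can have this property only piecewise, on its bounded parts;
   e.g. the whole diagonal, the graph of the h-monotone map x |-> {x}. *)
Definition rectifiable (R : realType) (m : nat) (V : normedModType R)
    (A : set V) : Prop :=
  exists (B : set 'rV[R]_m) (f : 'rV[R]_m -> V),
    [/\ bounded_set B, [lipschitz f u | u in B] & A = f @` B].

(* Main.v *)
Require Import Defs.
From HB Require Import structures.
From mathcomp Require Import all_boot all_order all_algebra.
From mathcomp Require Import all_classical all_reals all_analysis.
From mathcomp Require Import ring lra.
Import Order.TTheory GRing.Theory Num.Theory.
Import numFieldNormedType.Exports.
Local Open Scope classical_set_scope.
Local Open Scope ring_scope.

Set Implicit Arguments.
Unset Strict Implicit.
Unset Printing Implicit Defensive.

(** Let (x, xi) and (y, zeta) be two points of the graph S of T, and put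
    a = x - y and b = xi - zeta. The h-monotonicity of T says exactly that
      h(x - zeta) - h(x - xi) - (h(y - zeta) - h(y - xi)) >= 0,
    and the left side is a second difference of h. When both points are close
    to some (x0, y0) with w0 = x0 - y0 <> 0, the second difference is at most
    <a M, b> + eps |a| |b|, where M is the transpose of the Hessian of h
    at w0 ([second_difference_near]). By homogeneity this Hessian is a positive
    multiple of the one at the point w0 / |w0| of the sphere, so M is invertible
    ([hessian_unit]) and |a| is controlled by |a M|. Hence
      <a M, b> + |a M| |b| / 4 >= 0
    near (x0, y0): in the coordinates (x M, xi) the set S is almost monotone in
    the classical sense.

    Minty's trick then applies. For u = a M + b and v = a M - b the polarization
    identity |v|^2 = |u|^2 - 4 <a M, b> turns the last inequality into
    |v| <= C |u| ([minty_cone]). Thus, in the linear coordinates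
    (x M + xi, x M - xi), the part of S near (x0, y0) lies in a cone around each
    of its points, which makes it the graph of a Lipschitz map
    ([Lipschitz_graph_of_cone]); the linear map of the theorem is the inverse
    change of coordinates.

    On the diagonal there is nothing analytic: a set of pairs (x, x) is the
    image of its projection under x |-> (x, x), which is 1-Lipschitz. *)

(** * Sup norm and inner product on row vectors *)

Lemma ler_coord_norm (R : realType) (n : nat) (v : 'rV[R]_n) (j : 'I_n) :
  `|v 0 j| <= `|v|.
Proof.
rewrite [leRHS]/Num.Def.normr /= mx_normrE; apply/bigmax_geP; right => /=.
by exists (0, j).
Qed.

Lemma norm_rV_le (R : realType) (n : nat) (v : 'rV[R]_n) (e : R) :
  0 <= e -> (forall j, `|v 0 j| <= e) -> `|v| <= e.
Proof.
move=> e0 ve; rewrite [leLHS]/Num.Def.normr /= mx_normrE; apply/bigmax_leP.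
by split=> // -[i j] _ /=; rewrite ord1.
Qed.

Lemma norm_mulmx_le (R : realType) (n : nat) (u : 'rV[R]_n) (M : 'M[R]_n) :
  `|u *m M| <= n%:R * `|u| * `|M|.
Proof.
apply: norm_rV_le => [|j]; first by rewrite !mulr_ge0.
rewrite mxE (le_trans (ler_norm_sum _ _ _))//.
rewrite -[n in n%:R]card_ord -mulrA mulr_natl -sumr_const ler_sum// => k _.
rewrite normrM ler_pM ?ler_coord_norm//.
rewrite [leRHS]/Num.Def.normr /= mx_normrE; apply/bigmax_geP; right => /=.
by exists (k, j).
Qed.

Lemma dotvDl (R : realType) (n : nat) (u v w : 'rV[R]_n) :
  dotv (u + v) w = dotv u w + dotv v w.
Proof. by rewrite -big_split; apply: eq_bigr => i _; rewrite mxE mulrDl. Qed.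

Lemma dotvC (R : realType) (n : nat) (u v : 'rV[R]_n) : dotv u v = dotv v u.
Proof. by apply: eq_bigr => i _; rewrite mulrC. Qed.

Lemma dotvNl (R : realType) (n : nat) (u v : 'rV[R]_n) :
  dotv (- u) v = - dotv u v.
Proof. by rewrite -sumrN; apply: eq_bigr => i _; rewrite mxE mulNr. Qed.

Lemma norm_sqr_le_dotv (R : realType) (n : nat) (v : 'rV[R]_n) :
  `|v| ^+ 2 <= dotv v v.
Proof.
have d0 : 0 <= dotv v v by apply: sumr_ge0 => i _; rewrite -expr2 sqr_ge0.
rewrite -[leRHS]sqr_sqrtr// ler_pXn2r ?nnegrE ?sqrtr_ge0//.
apply: norm_rV_le => [|j]; first exact: sqrtr_ge0.
rewrite -sqrtr_sqr ler_sqrt// expr2 /dotv (bigD1 j)//= lerDl.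
by apply: sumr_ge0 => i _; rewrite -expr2 sqr_ge0.
Qed.

Lemma dotv_le_norm_sqr (R : realType) (n : nat) (v : 'rV[R]_n) :
  dotv v v <= n%:R * `|v| ^+ 2.
Proof.
rewrite -[n in n%:R]card_ord mulr_natl -sumr_const ler_sum// => i _.
by rewrite -expr2 -real_normK ?num_real// ler_pXn2r ?nnegrE// ler_coord_norm.
Qed.

(** * Minty's change of coordinates *)

(** Polarization gives <v, v> = <u, u> - 4 <a, b> for u = a + b and v = a - b,
    so a lower bound on <a, b> is an upper bound on v. The constant 1/4 is small
    enough for the error 4 * (1/4) * |a| |b| <= (|u|^2 + |v|^2) / 2 to be
    absorbed; the dimension enters through the comparison of the sup norm with
    the Euclidean one. *)
Lemma minty_cone (R : realType) (n : nat) (a b : 'rV[R]_n) :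
  0 <= dotv a b + 4^-1 * (`|a| * `|b|) ->
  `|a - b| <= (2 * n + 1)%:R * `|a + b|.
Proof.
set u := a + b; set v := a - b => ab0.
have polar : dotv v v = dotv u u - 4 * dotv a b.
  rewrite /u /v !(dotvDl, dotvNl, dotvC _ (_ + _), dotvC _ (_ - _)).
  by rewrite (dotvC b a); ring.
have aE : a = 2^-1 *: (u + v).
  by rewrite /u /v addrACA subrr addr0 -mulr2n -(scaler_nat 2 a) scalerA mulVf// scale1r.
have bE : b = 2^-1 *: (u - v).
  rewrite /u /v opprB addrC addrA subrK.
  by rewrite -mulr2n -(scaler_nat 2 b) scalerA mulVf// scale1r.
have a_le : `|a| <= 2^-1 * (`|u| + `|v|).
  by rewrite aE normrZ ger0_norm// ler_pM2l ?ler_normD.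
have b_le : `|b| <= 2^-1 * (`|u| + `|v|).
  by rewrite bE normrZ ger0_norm// ler_pM2l ?ler_normB.
have ab_le : `|a| * `|b| <= 2^-1 * (`|u| ^+ 2 + `|v| ^+ 2).
  apply: (le_trans (ler_pM _ _ a_le b_le)) => //.
  by have := sqr_ge0 (`|u| - `|v|); lra.
have v_le : `|v| ^+ 2 <= (2 * n + 1)%:R * `|u| ^+ 2.
  have := norm_sqr_le_dotv v; have := dotv_le_norm_sqr u.
  rewrite polar natrD natrM.
  set x := `|u| ^+ 2 in ab_le *; set y := `|v| ^+ 2 in ab_le *.
  set q := n%:R * x; have -> : (2 * n%:R + 1) * x = 2 * q + x by rewrite /q; ring.
  lra.
(* The bound on squares has the constant 2 n + 1 >= 1, which is at most its own
   square; this avoids a square root in the Lipschitz constant. *)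
rewrite -(@ler_pXn2r _ 2)// ?nnegrE ?mulr_ge0// exprMn.
apply: (le_trans v_le); rewrite ler_wpM2r ?sqr_ge0//.
by rewrite -natrX ler_nat -[leqLHS]expn1 leq_pexp2l// addn1.
Qed.

(** * Partial derivatives *)

Lemma is_derive_line (R : realType) (n : nat) (f : 'rV[R]_n -> R)
    (x v : 'rV[R]_n) (s : R) :
  derivable f (x + s *: v) v ->
  is_derive s 1 (fun t : R => f (x + t *: v)) ('D_v f (x + s *: v)).
Proof.
move=> df.
have E : (fun k => k^-1 *: (((fun t : R => f (x + t *: v)) \o shift s) (k *: 1)
                      - f (x + s *: v))) =
         (fun k => k^-1 *: ((f \o shift (x + s *: v)) (k *: v)
                      - f (x + s *: v))) :> (R -> R).
  apply/funext => k; rewrite /= [k *: 1]mulr1.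
  by rewrite scalerDl addrCA.
by split; rewrite ?/derivable ?/derive E.
Qed.

Lemma derivable_translate (R : realType) (n : nat) (f : 'rV[R]_n -> R)
    (b x v : 'rV[R]_n) :
  derivable f (x - b) v ->
  is_derive x v (fun z => f (z - b)) ('D_v f (x - b)).
Proof.
move=> df.
have E : (fun k => k^-1 *: (((fun z => f (z - b)) \o shift x) (k *: v)
                      - f (x - b))) =
         (fun k => k^-1 *: ((f \o shift (x - b)) (k *: v) - f (x - b))) :> (R -> R).
  by apply/funext => k; rewrite /= addrA.
by split; rewrite ?/derivable ?/derive E.
Qed.

(** Differentiate f(t x + s e) = t^p f(x + (s / t) e) at s = 0: the chain rule
    brings out the factor 1 / t. *)
Lemma homogeneous_partial (R : realType) (n : nat) (p : R)
    (f : 'rV[R]_n -> R) (i : 'I_n) :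
  (forall x, derivable f x (delta_mx 0 i)) -> homogeneous p f ->
  homogeneous (p - 1) (partial i f).
Proof.
move=> df hf t x t0; set e := delta_mx 0 i : 'rV[R]_n.
have t_neq0 : t != 0 by rewrite gt_eqF.
have E : (fun s : R => f (t *: x + s *: e)) =
         (t `^ p \*: ((fun s : R => f (x + s *: e)) \o (fun s => t^-1 *: s))).
  apply/funext => s /=; rewrite -[RHS]hf// scalerDr !scalerA.
  by rewrite mulrA mulfV// mul1r.
have d1 := @is_derive_line R n f (t *: x) e 0 (df _).
have d2 : is_derive (t^-1 *: (0 : R)) 1 (fun s : R => f (x + s *: e)) ('D_e f x).
  by rewrite scaler0; have := @is_derive_line R n f x e 0 (df _); rewrite scale0r addr0.
have d3 : is_derive (0 : R) 1 (fun s : R => t^-1 *: s : R) (t^-1 *: 1).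
  exact: is_deriveZ.
have d4 := is_deriveZ (t `^ p) (is_derive1_comp d2 d3).
rewrite -E in d4.
have := @derive_val _ _ _ _ _ _ _ d4; rewrite (@derive_val _ _ _ _ _ _ _ d1).
rewrite /partial -/e scale0r addr0 => ->.
rewrite powRB ?t_neq0 ?implybT// powRr1 ?ltW// /GRing.scale /= mulr1.
by rewrite mulrAC -mulrA.
Qed.

(** The mean value theorem is applied to t |-> f(x + t c e) on [0, 1], which
    treats both signs of c at once. *)
Lemma partial_mvt1 (R : realType) (n : nat) (f : 'rV[R]_n -> R) (i : 'I_n)
    (x : 'rV[R]_n) (c : R) :
  (forall z, derivable f z (delta_mx 0 i)) ->
  exists2 s : R, `|s| <= `|c| &
    f (x + c *: delta_mx 0 i) - f x = c * partial i f (x + s *: delta_mx 0 i).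
Proof.
move=> df; set e := delta_mx 0 i : 'rV[R]_n.
pose g (t : R) := f (x + (c *: t) *: e).
have dg (t : R) : is_derive t 1 g (c * partial i f (x + (c *: t) *: e)).
  have d1 := @is_derive_line R n f x e (c *: t) (df _).
  have d2 : is_derive t 1 (fun s : R => c *: s : R) (c *: 1) by exact: is_deriveZ.
  have := is_derive1_comp d1 d2; rewrite /GRing.scale /= mulr1 mulrC; exact.
have gc : {within `[0, 1], continuous g}.
  apply: continuous_subspaceT => t.
  have [dgt _] := dg t; exact/differentiable_continuous/derivable1_diffP.
have [t t01 E] := MVT_segment ler01 (fun t _ => dg t) gc.
exists (c * t).
  rewrite normrM ler_piMr// ger0_norm; last by rewrite (itvP t01).
  by rewrite (itvP t01).
move: E; rewrite /g [c *: 1]mulr1 [c *: 0]mulr0 scale0r addr0 subr0 mulr1.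
exact.
Qed.

(** Go from x to x + v by changing one coordinate at a time and use the
    one-variable mean value theorem on each leg. Every coordinate of every
    intermediate point moves by at most the corresponding coordinate of v, so
    in the sup norm these points stay within |v| of x. *)
Lemma partial_mvt (R : realType) (n : nat) (f : 'rV[R]_n -> R)
    (x v : 'rV[R]_n) :
  (forall i z, derivable f z (delta_mx 0 i)) ->
  exists2 xi : 'I_n -> 'rV[R]_n, (forall i, `|xi i - x| <= `|v|) &
    f (x + v) - f x = \sum_(i < n) v 0 i * partial i f (xi i).
Proof.
move=> df.
(* y k is x with its first k coordinates already moved. *)
pose y (k : nat) : 'rV[R]_n := x + \row_i (if (i < k)%N then v 0 i else 0).
have yS (k : 'I_n) : y k.+1 = y k + v 0 k *: delta_mx 0 k.
  rewrite /y -addrA; congr (_ + _); apply/rowP => j; rewrite !mxE eqxx /=.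
  rewrite ltnS leq_eqVlt (inj_eq val_inj); have [->|_] := eqVneq j k.
    by rewrite ltnn add0r mulr1.
  by rewrite mulr0 addr0.
have /choice[s s_prop] : forall i : 'I_n, exists s : R, `|s| <= `|v 0 i| /\
    f (y i.+1) - f (y i) = v 0 i * partial i f (y i + s *: delta_mx 0 i).
  move=> i; have [s sv E] := @partial_mvt1 R n f i (y i) (v 0 i) (df i).
  by exists s; rewrite yS.
exists (fun i : 'I_n => y i + s i *: delta_mx 0 i) => [i|].
  have [si _] := s_prop i.
  rewrite /y -!addrA addrC addrA subrK; apply: norm_rV_le => // j; rewrite !mxE eqxx /=.
  have [->|_] := eqVneq j i.
    by rewrite ltnn add0r mulr1 (le_trans si)// ler_coord_norm.
  rewrite mulr0 addr0; case: ifP => _; last by rewrite normr0.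
  exact: ler_coord_norm.
have -> : f (x + v) - f x = f (y n) - f (y 0%N).
  congr (f _ - f _); rewrite /y; first by congr (_ + _); apply/rowP => j; rewrite mxE ltn_ord.
  by rewrite -[LHS]addr0; congr (_ + _); apply/rowP => j; rewrite !mxE.
rewrite -(telescope_sumr (fun k => f (y k)))// big_mkord.
by apply: eq_bigr => i _; have [_ ->] := s_prop i.
Qed.

(** * Second differences and the Hessian *)

(** The left side is the increment along a of z |-> h z - h (z - b), whose
    partial derivatives are increments along b of those of h. Applying
    [partial_mvt] to each increment replaces the integral form of the second
    difference by a finite sum, with a different intermediate point for each
    entry of the Hessian. *)
Lemma second_difference (R : realType) (n : nat) (h : 'rV[R]_n -> R)
    (w a b : 'rV[R]_n) :
  C2 h ->
  exists2 eta : 'I_n -> 'I_n -> 'rV[R]_n,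
    (forall i j, `|eta i j - w| <= `|a| + 2 * `|b|) &
    h (w + a) - h (w + a - b) - (h w - h (w - b)) =
    \sum_(i < n) \sum_(j < n)
      a 0 i * b 0 j * partial j (partial i h) (eta i j).
Proof.
move=> [[_ h1] h2].
pose g z := h z - h (z - b).
have dg i z : is_derive z (delta_mx 0 i) g (partial i h z - partial i h (z - b)).
  have d1 : is_derive z (delta_mx 0 i) h (partial i h z).
    by split => //; have [+ _] := h1 i; exact.
  have [d2 _] := h1 i.
  exact: is_deriveB d1 (derivable_translate (d2 (z - b))).
have [xi xiw E] := @partial_mvt R n g w a (fun i z => @ex_derive _ _ _ _ _ _ _ (dg i z)).
have /choice[eta eta_prop] : forall i : 'I_n, exists eta : 'I_n -> 'rV[R]_n,
    (forall j, `|eta j - (xi i - b)| <= `|b|) /\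
    partial i g (xi i) = \sum_(j < n) b 0 j * partial j (partial i h) (eta j).
  move=> i; have [_ hi] := h2 i.
  have dhi j z : derivable (partial i h) z (delta_mx 0 j) by have [+ _] := hi j; exact.
  have [eta etaE Ei] := @partial_mvt R n (partial i h) (xi i - b) b dhi.
  exists eta; split => //.
  by rewrite /partial (@derive_val _ _ _ _ _ _ _ (dg i (xi i))) -Ei subrK.
exists eta => [i j|].
  have [etaE _] := eta_prop i.
  have -> : eta i j - w = (eta i j - (xi i - b)) + (xi i - w) - b.
    by rewrite opprB !addrA subrK addrAC addrK.
  have := etaE j; have := xiw i.
  have := ler_normB (eta i j - (xi i - b) + (xi i - w)) b.
  have := ler_normD (eta i j - (xi i - b)) (xi i - w).
  lra.
rewrite -[LHS]/(g (w + a) - g w) E; apply: eq_bigr => i _.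
have [_ ->] := eta_prop i; rewrite mulr_sumr.
by apply: eq_bigr => j _; rewrite mulrA.
Qed.

Lemma hessian_bilinear (R : realType) (n : nat) (h : 'rV[R]_n -> R)
    (w a b : 'rV[R]_n) :
  dotv (a *m (hessian h w)^T) b =
  \sum_(i < n) \sum_(j < n) a 0 i * b 0 j * partial j (partial i h) w.
Proof.
rewrite exchange_big /=; apply: eq_bigr => j _; rewrite mxE mulr_suml.
by apply: eq_bigr => i _; rewrite !mxE mulrAC.
Qed.

(** All the intermediate points of [second_difference] lie within
    |w - w0| + |a| + 2 |b| of w0, where the second partial derivatives are
    close to their values at w0 by continuity. *)
Lemma second_difference_near (R : realType) (n : nat) (h : 'rV[R]_n -> R)
    (w0 : 'rV[R]_n) (e : R) :
  C2 h -> 0 < e ->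
  exists2 d : R, 0 < d & forall w a b : 'rV[R]_n,
    `|w - w0| + `|a| + 2 * `|b| < d ->
    h (w + a) - h (w + a - b) - (h w - h (w - b)) <=
    dotv (a *m (hessian h w0)^T) b + e * (`|a| * `|b|).
Proof.
move=> h_C2 e0.
(* One share of the error for each of the n * n entries of the Hessian; the
   successor keeps the denominator nonzero when n = 0. *)
pose e' := e / (n * n).+1%:R.
have e'0 : 0 < e' by rewrite divr_gt0.
pose close (i j : 'I_n) : set 'rV[R]_n := fun z =>
  `|partial j (partial i h) w0 - partial j (partial i h) z| < e'.
have : \forall z \near w0, forall i j : 'I_n, close i j z.
  apply: (@filter_forall _ _ (fun i z => forall j, close i j z) (nbhs w0) _) => i.
  apply: (@filter_forall _ _ (close i) (nbhs w0) _) => j.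
  have [_ h2] := h_C2; have [_ h2i] := h2 i; have [_ cij] := h2i j.
  by have /cvgrPdist_lt/(_ _ e'0) := cij w0.
move=> /nbhs_ballP[d /= d0 dE]; exists d => // w a b wab.
have [eta etaw ->] := @second_difference R n h w a b h_C2.
rewrite hessian_bilinear -lerBlDl -sumrB.
have -> : e * (`|a| * `|b|) = (n * n).+1%:R * (e' * (`|a| * `|b|)).
  by rewrite /e'; field.
apply: (@le_trans _ _ (\sum_(i < n) \sum_(j < n) e' * (`|a| * `|b|))); last first.
  rewrite !sumr_const !card_ord -mulrnA -(mulr_natl _ (n * n)) ler_wpM2r ?ler_nat//.
  by rewrite !mulr_ge0// ltW.
apply: ler_sum => i _; rewrite -sumrB; apply: ler_sum => j _.
rewrite -mulrBr; apply: (le_trans (ler_norm _)); rewrite normrM [leLHS]mulrC.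
rewrite ler_pM//; last by rewrite normrM ler_pM// ler_coord_norm.
rewrite distrC ltW//; apply: dE; rewrite -ball_normE /= distrC.
apply: le_lt_trans wab.
have -> : eta i j - w0 = (eta i j - w) + (w - w0) by rewrite addrA subrK.
by apply: (le_trans (ler_normD _ _)); have := etaw i j; lra.
Qed.

(** The second partial derivatives are homogeneous of degree p - 2, so the
    Hessian at w is a positive multiple of the one at w / |w|, with |w| the
    Euclidean length; there the positive definite form has trivial kernel. *)
Lemma hessian_unit (R : realType) (n : nat) (p : R) (h : 'rV[R]_n -> R)
    (w : 'rV[R]_n) :
  C2 h -> homogeneous p h ->
  (forall x : 'rV[R]_n, sphere x -> posdef (hessian h x)) ->
  w != 0 -> (hessian h w)^T \in unitmx.
Proof.
move=> [[_ h1] h2] hh hpos w0.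
have hess_hom i j : homogeneous (p - 1 - 1) (partial i (partial j h)).
  apply: homogeneous_partial.
    by have [_ h2j] := h2 j; have [+ _] := h2j i.
  by apply: homogeneous_partial => //; have [+ _] := h1 j.
have ww0 : 0 < dotv w w.
  by apply: lt_le_trans (norm_sqr_le_dotv w); rewrite exprn_gt0// normr_gt0.
pose r := Num.sqrt (dotv w w).
have r0 : 0 < r by rewrite sqrtr_gt0.
have sph : sphere (r^-1 *: w).
  rewrite /sphere /= /dotv.
  under eq_bigr do rewrite !mxE mulrACA.
  rewrite -mulr_sumr -expr2 exprVn sqr_sqrtr ?ltW// mulVf// gt_eqF//.
have HE : hessian h w = r `^ (p - 1 - 1) *: hessian h (r^-1 *: w).
  apply/matrixP => i j; rewrite !mxE -hess_hom// scalerA mulfV ?scale1r//.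
  by rewrite gt_eqF.
rewrite -row_free_unit; apply: inj_row_free => v.
rewrite HE linearZ /= -scalemxAr => /eqP; rewrite scaler_eq0 gt_eqF ?powR_gt0//=.
move=> /eqP v0; apply/eqP; apply: contraT => /(hpos _ sph).
by rewrite v0 /dotv big1 ?ltxx// => i _; rewrite mxE mul0r.
Qed.

(** * Lipschitz graphs *)

(** The bound makes the second component a function of the first, since points
    with equal first components have equal second components, and the same
    bound is its Lipschitz condition. *)
Lemma Lipschitz_graph_of_cone (R : realType) (n : nat) (k : R)
    (G : set ('rV[R]_n * 'rV[R]_n)) :
  (forall y z, G y -> G z -> `|y.2 - z.2| <= k * `|y.1 - z.1|) ->
  Lipschitz_graph G.
Proof.
move=> Gk.
(* F u is any v with (u, v) in G, and is arbitrary if there is none. *)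
have /choice[F FG] : forall u : 'rV[R]_n, exists v, forall v', G (u, v') -> G (u, v).
  move=> u; have [[v Guv]|nG] := pselect (exists v, G (u, v)); first by exists v.
  by exists 0 => v' Gv'; exfalso; apply: nG; exists v'.
have GF z : G z -> G (z.1, F z.1) by case: z => u v; exact: FG.
have FE z : G z -> F z.1 = z.2.
  move=> Gz; apply/eqP; rewrite -subr_eq0 -normr_le0.
  by have := Gk _ _ (GF _ Gz) Gz; rewrite /= subrr normr0 mulr0.
exists (fst @` G), F; split; last first.
  apply/seteqP; split => [z Gz|_ [u [z Gz <-]] <-]; last exact: GF.
  by exists z.1; [exists z | rewrite FE//; case: z {Gz}].
have [[z0 Gz0]|nG] := pselect (exists z, G z); last first.
  have -> : fst @` G = set0.
    by apply/seteqP; split => // u [z Gz _]; apply: nG; exists z.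
  exact: lipschitz_set0.
apply: (@klipschitzW _ _ _ k).
  apply: (@globally_properfilter _ _ (z0.1, z0.1)).
  by split; exists z0.
move=> [u v] /= [[y Gy <-] [z Gz <-]].
by rewrite !FE//; exact: Gk.
Qed.

(** Minty's coordinates: the sum and the difference of x M and xi for
    z = (x, xi). *)
Definition minty_map (R : realType) (n : nat) (M : 'M[R]_n)
    (z : 'rV[R]_n * 'rV[R]_n) : 'rV[R]_n * 'rV[R]_n :=
  (z.1 *m M + z.2, z.1 *m M - z.2).

Definition minty_inv (R : realType) (n : nat) (M : 'M[R]_n)
    (z : 'rV[R]_n * 'rV[R]_n) : 'rV[R]_n * 'rV[R]_n :=
  (2^-1 *: (z.1 + z.2) *m invmx M, 2^-1 *: (z.1 - z.2)).

Lemma minty_inv_is_linear (R : realType) (n : nat) (M : 'M[R]_n) :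
  linear (minty_inv M).
Proof.
move=> c [u v] [u' v']; rewrite /minty_inv /=; congr (_, _) => /=.
  rewrite addrACA -scalerDr [2^-1 *: _]scalerDr mulmxDl; congr (_ + _).
  by rewrite scalerA mulrC -scalerA scalemxAl.
rewrite opprD addrACA -scalerBr [2^-1 *: _]scalerDr; congr (_ + _).
by rewrite scalerA mulrC -scalerA.
Qed.

HB.instance Definition _ (R : realType) (n : nat) (M : 'M[R]_n) :=
  GRing.isLinear.Build R ('rV[R]_n * 'rV[R]_n)%type ('rV[R]_n * 'rV[R]_n)%type
    _ (minty_inv M) (minty_inv_is_linear M).

Lemma minty_mapK (R : realType) (n : nat) (M : 'M[R]_n) :
  M \in unitmx -> cancel (minty_map M) (minty_inv M).
Proof.
move=> Mu [x y]; rewrite /minty_inv /minty_map /=; congr (_, _).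
  rewrite addrACA subrr addr0 -mulr2n -(scaler_nat 2 (x *m M)) scalerA mulVf//.
  by rewrite scale1r mulmxK.
rewrite opprB addrC addrA subrK -mulr2n -(scaler_nat 2 y) scalerA mulVf//.
by rewrite scale1r.
Qed.

(** * The local cone condition and the theorem *)

(** Near a point off the diagonal the monotonicity inequality bounds
    <a M, b> from below by - eps |a| |b|, and |a| is at most a multiple of |a M|
    since M is invertible; for eps small [minty_cone] applies to a M and b. *)
Lemma hmonotone_cone (R : realType) (n : nat) (p : R) (h : 'rV[R]_n -> R)
    (T : 'rV[R]_n -> set 'rV[R]_n) (z0 : 'rV[R]_n * 'rV[R]_n) :
  C2 h -> homogeneous p h ->
  (forall x : 'rV[R]_n, sphere x -> posdef (hessian h x)) ->
  hmonotone h T -> z0.1 != z0.2 ->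
  let M := (hessian h (z0.1 - z0.2))^T in
  M \in unitmx /\
  exists2 r : R, 0 < r & forall y z,
    mgraph T y -> mgraph T z -> ball z0 r y -> ball z0 r z ->
    `|(minty_map M y).2 - (minty_map M z).2| <=
    (2 * n + 1)%:R * `|(minty_map M y).1 - (minty_map M z).1|.
Proof.
move=> h_C2 hh hpos hT z01 M.
have Mu : M \in unitmx by apply: (hessian_unit h_C2 hh hpos); rewrite subr_eq0.
split=> //.
(* |a| <= K |a M|, so an error of 1 / (4 K) in the second difference is the 1/4
   that the cone estimate tolerates. *)
pose K := n%:R * `|invmx M| + 1.
have K0 : 0 < K by rewrite ltr_wpDl// mulr_ge0.
have e0 : 0 < 4^-1 / K by rewrite divr_gt0.
have [d d0 dE] := second_difference_near (z0.1 - z0.2) h_C2 e0.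
(* The vectors y - zeta - (z0.1 - z0.2), a and b have norm at most twice the
   radius, and b counts twice, so 8 radii must fit into d. *)
exists (d / 8) => [|[x xi] [y zeta] [/= Txi dx] [/= Tzeta dy]]; first by rewrite divr_gt0.
move=> [/= x0 xi0] [/= y0 zeta0].
move: x0 xi0 y0 zeta0; rewrite -!ball_normE /= => x0 xi0 y0 zeta0.
set a := x - y; set b := xi - zeta.
have -> : x *m M - xi - (y *m M - zeta) = a *m M - b.
  by rewrite opprD addrACA mulmxBl opprK opprB [- xi + _]addrC.
have -> : x *m M + xi - (y *m M + zeta) = a *m M + b.
  by rewrite opprD addrACA mulmxBl.
have aw : `|a| <= `|z0.1 - x| + `|z0.1 - y|.
  by rewrite -(distrC x); have := ler_distD z0.1 x y.
have bw : `|b| <= `|z0.2 - xi| + `|z0.2 - zeta|.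
  by rewrite -(distrC xi); have := ler_distD z0.2 xi zeta.
have ww : `|y - zeta - (z0.1 - z0.2)| <= `|z0.1 - y| + `|z0.2 - zeta|.
  rewrite distrC opprB [zeta - y]addrC addrACA [- z0.2 + _]addrC -(distrC zeta).
  exact: ler_normD.
have /dE : `|y - zeta - (z0.1 - z0.2)| + `|a| + 2 * `|b| < d by lra.
have -> : y - zeta + a = x - zeta by rewrite /a addrC addrA subrK.
have -> : x - zeta - b = x - xi by rewrite /b opprB addrA subrK.
have -> : y - zeta - b = y - xi by rewrite /b opprB addrA subrK.
have := hT _ _ _ _ dx dy Txi Tzeta => mono diff.
apply: minty_cone.
have diff0 : 0 <= dotv (a *m M) b + 4^-1 / K * (`|a| * `|b|) by rewrite -/M in diff; lra.
apply: (le_trans diff0); rewrite lerD2l -mulrA ler_pM2l ?invr_gt0//.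
rewrite ler_pdivrMl// mulrA ler_wpM2r//.
have -> : a = (a *m M) *m invmx M by rewrite mulmxK.
apply: (le_trans (norm_mulmx_le _ _)); rewrite mulmxKV//.
by rewrite /K mulrDl mulrAC lerDl mul1r.
Qed.

Lemma norm_diag (R : realType) (V : normedModType R) (x : V) :
  `|(x, x)| = `|x|.
Proof. by rewrite prod_normE maxxx. Qed.

Lemma lipschitz_diag (R : realType) (V : normedModType R) (A : set V) :
  [lipschitz (x, x) | x in A].
Proof.
have [[a Aa]|nA] := pselect (exists a, A a); last first.
  have -> : A = set0 by apply/seteqP; split => // a Aa; apply: nA; exists a.
  exact: lipschitz_set0.
apply: (@klipschitzW _ _ _ 1).
  exact: (@globally_properfilter _ _ (a, a)).
move=> [x y] _ /=; rewrite mul1r.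
by rewrite -[X in `|X|]/(x - y, x - y) norm_diag.
Qed.

Theorem mainTheorem4 (R : realType) (n : nat) (p : R) (h : 'rV[R]_n -> R)
    (T : 'rV[R]_n -> set 'rV[R]_n)
    (p_ge2 : 2 <= p)
    (h_C2 : C2 h)
    (h_ge0 : forall x : 'rV[R]_n, 0 <= h x)
    (h_homogeneous : homogeneous p h)
    (h_hessian : forall x : 'rV[R]_n, sphere x -> posdef (hessian h x))
    (T_hmonotone : hmonotone h T) :
  let S := mgraph T in
  let D := @diagonal 'rV[R]_n in
  (forall z0 : 'rV[R]_n * 'rV[R]_n, (S `&` ~` D) z0 ->
     exists N : set ('rV[R]_n * 'rV[R]_n), nbhs z0 N /\
       exists (L : {linear ('rV[R]_n * 'rV[R]_n)%type ->
                           ('rV[R]_n * 'rV[R]_n)%type})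
              (G : set ('rV[R]_n * 'rV[R]_n)),
         Lipschitz_graph G /\ S `&` ~` D `&` N = L @` G) /\
  ((S `&` D = (fun x : 'rV[R]_n => (x, x)) @` (fst @` (S `&` D)) /\
    lipschitz (fun x : 'rV[R]_n => (x, x))) /\
   forall B : set ('rV[R]_n * 'rV[R]_n), bounded_set B ->
     rectifiable n (S `&` D `&` B)).
Proof.
move=> S D.
have diag_image (A : set ('rV[R]_n * 'rV[R]_n)) : A `<=` D ->
    A = (fun x => (x, x)) @` (fst @` A).
  move=> AD; apply/seteqP; split => [z Az|_ [_ [z Az <-] <-]].
    by exists z.1; [exists z | rewrite [in RHS](surjective_pairing z) -(AD _ Az)].
  by rewrite [X in (_, X)](AD _ Az) -surjective_pairing.
split; [move=> z0 [_ Dz0] | split; [split |]].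
- have z01 : z0.1 != z0.2 by apply/eqP.
  have [Mu [r r0 cone]] :=
    hmonotone_cone h_C2 h_homogeneous h_hessian T_hmonotone z01.
  set M := (hessian h (z0.1 - z0.2))^T in Mu cone.
  exists (ball z0 r); split; first exact: nbhsx_ballx.
  exists (minty_inv M), (minty_map M @` (S `&` ~` D `&` ball z0 r)); split.
    apply: (@Lipschitz_graph_of_cone _ _ (2 * n + 1)%:R).
    by move=> _ _ [y [[Sy _] By] <-] [z [[Sz _] Bz] <-]; exact: cone.
  rewrite image_comp; apply/esym.
  under eq_imagel do rewrite /= minty_mapK//.
  exact: image_id.
- by apply: diag_image => z [].
- exact: lipschitz_diag.
- move=> B [b [b_real bB]].
  exists (fst @` (S `&` D `&` B)), (fun x => (x, x)); split.
  + exists b; split=> // c bc _ [z [[_ Dz] Bz] <-] /=.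
    by rewrite -norm_diag [X in (_, X)]Dz -surjective_pairing; exact: bB.
  + exact: lipschitz_diag.
  + by apply: diag_image => z [[]].
Qed.
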